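(* Let $\mathbf S = (S,+,0)$ be a join semilattice with least element $0$ and greatest element $1$, and let $\mathbf M$ be a reductive, right cancellative monoid of operators acting on $\mathbf S$. Assume that $f(1)=1$ for every $f \in \mathbf M$. Then there is a quasivariety $\mathscr D$ of structures such that the lattice of quasi-equational theories of $\mathscr D$ is isomorphic to $\operatorname{Con}(\mathbf S,+,0,\mathbf M)$.
   Context: Operators: an operator on a join semilattice $(S,+,0)$ with least element $0$ is an endomorphism of $(S,+,0)$, i.e. a map $f:S\to S$ with $f(s+t)=f(s)+f(t)$ and $f(0)=0$. A monoid of operators is a set of operators containing the identity map and closed under composition. $\operatorname{Con}(\mathbf S,+,0,\mathbf M)$ is the lattice (ordered by inclusion) of all equivalence relations on $S$ compatible with $+$ and with every $f\in\mathbf M$. A monoid $\mathbf M$ is reductive if for every pair $f,g\in\mathbf M$ there is $h\in\mathbf M$ such that either $f=hg$ or $g=hf$. A monoid $\mathbf M$ is right cancellative if $gf=hf$ implies $g=h$ for all $f,g,h\in\mathbf M$. Products in a monoid of operators are compositions, $(gf)(s)=g(f(s))$. Structures may have both operations and relations (and constants); the language may be infinite. Atomic formulae are $s\approx t$ or $R(s_1,\dots,s_k)$ with $s,t,s_i$ terms and $R$ a relation symbol. A quasi-identity is a universally quantified implication $\alpha_1\,\&\cdots\&\,\alpha_n \Rightarrow \beta$ with $n\ge 0$ and all $\alpha_i,\beta$ atomic formulae. A quasivariety is the class of all structures of a given language satisfying some set of quasi-identities. A quasi-equational theory is a set of quasi-identities closed under logical consequence (among quasi-identities). The lattice of quasi-equational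 theories of a quasivariety $\mathscr D$ is the lattice, ordered by inclusion, of all quasi-equational theories (in the language of $\mathscr D$) containing the quasi-equational theory of $\mathscr D$; equivalently, it is the dual of the lattice of sub-quasivarieties of $\mathscr D$. *)

(* Defs.v *)
From Stdlib Require Import Relation_Definitions.
From Stdlib Require List.
From mathcomp Require Import all_boot all_order.
From mathcomp Require Import boolp classical_sets functions.

Set Implicit Arguments.
Unset Strict Implicit.
Unset Printing Implicit Defensive.

Local Open Scope classical_set_scope.

Section Operators.
Variables (d : Order.disp_t) (S : tbJoinSemilatticeType d).
Implicit Types (f g h : S -> S) (M : set (S -> S)) (R : set (S * S)).

Definition operator f : Prop :=
  (forall s t, f (s `|` t)%O = (f s `|` f t)%O) /\ f \bot%O = \bot%O.

Definition operator_monoid M : Prop :=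
  [/\ forall f, M f -> operator f,
      M id
    & forall f g, M f -> M g -> M (g \o f)].

Definition reductive M : Prop :=
  forall f g, M f -> M g ->
    exists2 h, M h & f = h \o g \/ g = h \o f.

Definition right_cancellative M : Prop :=
  forall f g h, M f -> M g -> M h -> g \o f = h \o f -> g = h.

(* A binary relation on S is represented by its graph. *)
Definition Con M : set (set (S * S)) :=
  [set R | [/\ equivalence S (fun s t => R (s, t)),
               forall s t u v,
                 R (s, t) -> R (u, v) -> R ((s `|` u)%O, (t `|` v)%O)
             & forall f s t, M f -> R (s, t) -> R (f s, f t)]].

End Operators.

(* Constants are the operation symbols of arity 0. *)
Record language := Language {
  op_symbol : Type;
  op_arity : op_symbol -> nat;
  rel_symbol : Type;
  rel_arity : rel_symbol -> nat;
  rel_arity_gt0 : forall r, 0 < rel_arity r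
}.

Record structure (L : language) := Structure {
  carrier :> Type;
  carrier_inhabited : inhabited carrier;
  op_interp : forall o : op_symbol L, ('I_(op_arity o) -> carrier) -> carrier;
  rel_interp : forall r : rel_symbol L, ('I_(rel_arity r) -> carrier) -> Prop
}.

Section Logic.
Variable L : language.

Inductive term :=
  | Var of nat
  | App (o : op_symbol L) of ('I_(op_arity o) -> term).

Inductive atomic :=
  | Eqn of term & term
  | Rel (r : rel_symbol L) of ('I_(rel_arity r) -> term).

Record quasi_identity := QuasiIdentity {
  premises : seq atomic;
  conclusion : atomic
}.

Section Satisfaction.
Variable A : structure L.

Fixpoint eval (v : nat -> A) (t : term) : A :=
  match t with
  | Var i => v i
  | App o ts => op_interp (fun i => eval v (ts i))
  end.

Definition holds (v : nat -> A) (a : atomic) : Prop :=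
  match a with
  | Eqn s t => eval v s = eval v t
  | Rel r ts => rel_interp (fun i => eval v (ts i))
  end.

Definition satisfies (q : quasi_identity) : Prop :=
  forall v : nat -> A,
    (forall a, List.In a (premises q) -> holds v a) -> holds v (conclusion q).

Definition models (T : set quasi_identity) : Prop :=
  forall q, T q -> satisfies q.

End Satisfaction.

Definition quasivariety (D : structure L -> Prop) : Prop :=
  exists T : set quasi_identity, forall A, D A <-> models A T.

Definition theory_of (D : structure L -> Prop) : set quasi_identity :=
  [set q | forall A, D A -> satisfies A q].

Definition quasi_equational_theory (T : set quasi_identity) : Prop :=
  forall q, (forall A : structure L, models A T -> satisfies A q) -> T q.

Definition theories (D : structure L -> Prop) : set (set quasi_identity) :=
  [set T | quasi_equational_theory T /\ theory_of D `<=` T].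

End Logic.

(* P and Q are lattices under inclusion. A bijection preserving and reflecting
   inclusion preserves and reflects all joins and meets that exist, hence is
   the same thing as a lattice isomorphism. *)
Definition inclusion_isomorphic (A B : Type)
    (P : set (set A)) (Q : set (set B)) : Prop :=
  exists2 F : set A -> set B,
    set_bij P Q F
    & forall X Y, P X -> P Y -> (X `<=` Y <-> F X `<=` F Y).

(* Main.v *)
Require Import Defs.
From mathcomp Require Import all_boot all_order.
From mathcomp Require Import boolp classical_sets functions.

Set Implicit Arguments.
Unset Strict Implicit.
Unset Printing Implicit Defensive.

Import Order.TTheory.
Local Open Scope classical_set_scope.

(** A semilattice with operators is coded by structures with a unary function
    symbol for each f in M, a unary predicate P_s for each s in S, and a
    constant, the point.  At an element x, the s with P_s(x) form an ideal, and
    P_s(f x) is equivalent to P_(f s)(x); so a word of function symbols applied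
    to x can be eliminated, and every relational fact about the substructure
    generated by x is a fact P_s(x).  In this way a theory T is expected to
    amount to the relation theta_T of all (s, t) such that T proves P_s(x) and
    P_t(x) equivalent, and substituting f x for x makes theta_T compatible with
    f.

    The two features of quasi-identities that S does not see are premises on
    several variables and equations.  The remaining axioms make both harmless.
    The point satisfies all P_s and is the only element that satisfies P_1.
    Because f(1) = 1, the point is fixed by every f and is reached by f from
    itself only; hence all elements that have no common descendant with a given
    c can be sent to the point without violating any operation or predicate.
    The words act freely away from the point: the function symbols are
    injective, different ones have disjoint images up to the point, and no
    nonempty word fixes an element other than the point.  The letters are thus
    composed as free words, whatever the relations of M are.  Consequently two
    elements with a common descendant other than the point are comparable, and
    for finitely many values in a model A some ancestor c of a chosen one can be
    found (common_ancestor) such that each value either lies in the substructure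
    generated by c, which is free, or has no common descendant with c.

    If theta_T is contained in theta_T', then T is contained in T'
    (congruence_of_reflects): given a quasi-identity of T that fails in a model
    A of T', its premises require only one P_s(c), its conclusion only one
    P_t(c) to be refuted, and separating_model gives a model B of T with an
    element b satisfying P_s and not P_t.  Sending each word applied to c to the
    same word applied to b, and everything else to the point, would carry the
    failure to B.  Conversely every R in Con is a theta_T
    (theory_of_congruenceK): the free structure whose generator satisfies the
    ideal of all u with (u + t) R t separates t from any s outside that
    ideal. *)

(** * Valuations and the variables of a term *)

Section Variables_of_terms.
Variable L : language.

Fixpoint term_bound (t : term L) : nat :=
  match t with
  | Var i => i.+1
  | App o ts => \max_i term_bound (ts i)
  end.

Definition atomic_bound (a : atomic L) : nat :=
  match a with
  | Eqn s t => maxn (term_bound s) (term_bound t)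
  | Rel r ts => \max_i term_bound (ts i)
  end.

(** Logical relations: only the finitely many variables that occur matter, so
    the valuations need not be related everywhere. *)
Lemma eval_related (A B : structure L) (rho : A -> B -> Prop) (n : nat)
    (v : nat -> A) (v' : nat -> B) (t : term L) :
    (forall (o : op_symbol L) xs ys, (forall i, rho (xs i) (ys i)) ->
       rho (op_interp (o := o) xs) (op_interp (o := o) ys)) ->
    (forall i, i < n -> rho (v i) (v' i)) ->
  term_bound t <= n -> rho (eval v t) (eval v' t).
Proof.
move=> rho_op rho_v; elim: t => [i|o ts IH] /= le_n; first exact: rho_v.
apply: rho_op => i; apply: IH; apply: leq_trans le_n.
exact: (leq_bigmax (F := fun j => term_bound (ts j))).
Qed.

Lemma premises_bounded (ps : seq (atomic L)) :
  exists n, forall a, List.In a ps -> atomic_bound a <= n.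
Proof.
elim: ps => [|a ps [n IH]]; first by exists 0.
exists (maxn (atomic_bound a) n) => b [<-|/IH le_n]; first exact: leq_maxl.
exact: leq_trans le_n (leq_maxr _ _).
Qed.

End Variables_of_terms.

(** * The language and the axioms *)

Section Representation.
Variables (d : Order.disp_t) (S : tbJoinSemilatticeType d).
Variable M : set (S -> S).

(** The words are kept free, instead of being composed in M, so that equations
    between them carry no information. *)
Definition letter : Type := {f : S -> S | M f}.
Definition word := seq letter.

Definition act_language : language :=
  @Language (option letter) (fun o => if o is Some _ then 1 else 0)
            S (fun _ => 1) (fun _ => isT).
Local Notation L := act_language.

Definition no_args (X : Type) (i : 'I_0) : X := False_rect X (notF (ltn_ord i)).

Definition tlapp (f : letter) (t : term L) : term L :=
  App (L := L) (o := Some f) (fun _ => t).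
Definition tpoint : term L := App (L := L) (o := None) (@no_args _).
Definition tmarked (s : S) (t : term L) : atomic L :=
  Rel (L := L) (r := s) (fun _ => t).
Definition twapp (w : word) (t : term L) : term L := foldr tlapp t w.

Section Interpretation.
Variable A : structure L.

Definition lapp (f : letter) (x : A) : A := @op_interp L A (Some f) (fun _ => x).
Definition point : A := @op_interp L A None (@no_args _).
Definition marked (s : S) (x : A) : Prop := @rel_interp L A s (fun _ => x).
Definition wapp (w : word) (x : A) : A := foldr lapp x w.

Lemma op_interp_lapp f xs : @op_interp L A (Some f) xs = lapp f (xs ord0).
Proof. by congr op_interp; apply/funext => i; rewrite (ord1 i). Qed.

Lemma op_interp_point xs : @op_interp L A None xs = point.
Proof. by congr op_interp; apply/funext => i; case: (no_args False i). Qed.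

Lemma rel_interp_marked s xs : @rel_interp L A s xs = marked s (xs ord0).
Proof. by congr rel_interp; apply/funext => i; rewrite (ord1 i). Qed.

Lemma eval_tpoint v : eval v tpoint = point.
Proof. exact: op_interp_point. Qed.

Lemma eval_twapp v w t : eval v (twapp w t) = wapp w (eval v t).
Proof. by elim: w => //= f w <-. Qed.

Lemma wapp_cat w u x : wapp (w ++ u) x = wapp w (wapp u x).
Proof. exact: foldr_cat. Qed.

End Interpretation.

Arguments point : clear implicits.

Notation x0 := (Var L 0).
Notation x1 := (Var L 1).

Definition implication (s t : S) : quasi_identity L :=
  QuasiIdentity [:: tmarked s x0] (tmarked t x0).

Lemma implicationP A s t :
  satisfies A (implication s t) <-> forall x : A, marked s x -> marked t x.
Proof.
split=> [sat x sx | imp v prem]; last by apply: imp; apply: (prem (tmarked s x0)); left.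
by apply: (sat (fun _ => x)) => a [<-|[]].
Qed.

(** A conclusion [x0 = tpoint] stands for an impossibility: quasi-identities
    cannot forbid anything, but they can confine an exception to the point. *)
Inductive axiom : quasi_identity L -> Prop :=
| Ax_bot : axiom (QuasiIdentity [::] (tmarked \bot%O x0))
| Ax_join s t :
    axiom (QuasiIdentity [:: tmarked s x0; tmarked t x0] (tmarked (s `|` t)%O x0))
| Ax_part s t : axiom (implication (s `|` t)%O s)
| Ax_push f s :
    axiom (QuasiIdentity [:: tmarked s (tlapp f x0)] (tmarked (sval f s) x0))
| Ax_pull f s :
    axiom (QuasiIdentity [:: tmarked (sval f s) x0] (tmarked s (tlapp f x0)))
| Ax_top_point : axiom (QuasiIdentity [::] (tmarked \top%O tpoint))
| Ax_top : axiom (QuasiIdentity [:: tmarked \top%O x0] (Eqn x0 tpoint))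
| Ax_inj f : axiom (QuasiIdentity [:: Eqn (tlapp f x0) (tlapp f x1)] (Eqn x0 x1))
| Ax_disjoint f g : f <> g ->
    axiom (QuasiIdentity [:: Eqn (tlapp f x0) (tlapp g x1)] (Eqn x0 tpoint))
| Ax_acyclic w : w <> [::] ->
    axiom (QuasiIdentity [:: Eqn (twapp w x0) x0] (Eqn x0 tpoint)).

Record lawful (A : structure L) : Prop := Lawful {
  marked_bot : forall x : A, marked \bot%O x;
  marked_join : forall s t (x : A), marked (s `|` t)%O x <-> marked s x /\ marked t x;
  marked_lapp : forall f s (x : A), marked s (lapp f x) <-> marked (sval f s) x;
  marked_top : forall x : A, marked \top%O x <-> x = point A;
  lapp_inj : forall f (x y : A), lapp f x = lapp f y -> x = y;
  lapp_disjoint : forall f g (x y : A), f <> g -> lapp f x = lapp g y -> x = point A;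
  wapp_acyclic : forall w (x : A), w <> [::] -> wapp w x = x -> x = point A
}.

Lemma axiomsP A : models A axiom <-> lawful A.
Proof.
split=> [mod | law].
  have use q (x y : A) : axiom q ->
      (forall a, List.In a (premises q) ->
         holds (fun n => if n is 0 then x else y) a) ->
      holds (fun n => if n is 0 then x else y) (conclusion q).
    by move=> axq; apply: (mod q axq).
  have tpE v : eval v tpoint = point A by exact: eval_tpoint.
  split.
  - by move=> x; apply: (use _ x x Ax_bot) => a [].
  - move=> s t x; split=> [stx|[sx tx]].
      split; last rewrite joinC in stx;
        by apply: (use _ x x (Ax_part _ _)) => a [<-|[]]; exact: stx.
    by apply: (use _ x x (Ax_join s t)) => a [<-|[<-|[]]].
  - move=> f s x; split=> h.
      by apply: (use _ x x (Ax_push f s)) => a [<-|[]].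
    by apply: (use _ x x (Ax_pull f s)) => a [<-|[]].
  - move=> x; split=> [tx|->].
      by rewrite -(tpE (fun n => if n is 0 then x else x));
         apply: (use _ x x Ax_top) => a [<-|[]].
    by rewrite -(tpE (fun n => if n is 0 then x else x));
       apply: (use _ x x Ax_top_point) => a [].
  - by move=> f x y e; apply: (use _ x y (Ax_inj f)) => a [<-|[]].
  - move=> f g x y fg e; rewrite -(tpE (fun n => if n is 0 then x else y)).
    by apply: (use _ x y (Ax_disjoint fg)) => a [<-|[]].
  - move=> w x w0 e; rewrite -(tpE (fun n => if n is 0 then x else x)).
    by apply: (use _ x x (Ax_acyclic w0)) => a [<-|[]] //=; rewrite eval_twapp.
move=> q [|s t|s t|f s|f s|||f|f g fg|w w0] v /= prem.
- exact: marked_bot.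
- apply/(marked_join law); split.
    by apply: (prem (tmarked s x0)); left.
  by apply: (prem (tmarked t x0)); right; left.
- by have /(marked_join law)[] := prem _ (or_introl erefl).
- by apply/(marked_lapp law); apply: (prem _ (or_introl erefl)).
- by apply/(marked_lapp law); apply: (prem _ (or_introl erefl)).
- by rewrite rel_interp_marked op_interp_point; apply/(marked_top law).
- by rewrite op_interp_point; apply/(marked_top law); apply: (prem _ (or_introl erefl)).
- exact: (lapp_inj law (prem _ (or_introl erefl))).
- rewrite op_interp_point.
  exact: (lapp_disjoint law fg (prem _ (or_introl erefl))).
- rewrite op_interp_point; apply: (wapp_acyclic law w0).
  by rewrite -[LHS](eval_twapp v w x0); apply: (prem _ (or_introl erefl)).
Qed.

(** The letter nearest to the element acts on S last: P_s(f (g x)) means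
    P_(f s)(g x), that is P_(g (f s))(x). *)
Definition wact (w : word) (s : S) : S := foldl (fun u f => sval f u) s w.

Hypothesis M_op : forall f, M f -> operator f.
Hypothesis M_top : forall f, M f -> f \top%O = \top%O.

(** * Freeness away from the point *)

Section Lawful.
Variable A : structure L.
Hypothesis law : lawful A.

Lemma marked_wapp w s (x : A) : marked s (wapp w x) <-> marked (wact w s) x.
Proof.
elim: w s => //= f w IH s.
by split=> [/(marked_lapp law)/IH // | h]; apply/(marked_lapp law)/IH.
Qed.

Lemma lapp_point f : lapp f (point A) = point A.
Proof.
apply/(marked_top law)/(marked_lapp law); rewrite (M_top (svalP f)).
exact/(marked_top law).
Qed.

Lemma wapp_point w : wapp w (point A) = point A.
Proof. by elim: w => //= f w ->; apply: lapp_point. Qed.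

Lemma lapp_eq_point f (x : A) : lapp f x = point A -> x = point A.
Proof. by rewrite -{1}(lapp_point f) => /(lapp_inj law). Qed.

Lemma wapp_eq_point w (x : A) : wapp w x = point A -> x = point A.
Proof. by elim: w => //= f w IH /lapp_eq_point. Qed.

Lemma marked_point s : marked s (point A).
Proof.
have /(marked_top law) : point A = point A by [].
by rewrite -(joinx1 s) => /(marked_join law)[].
Qed.

(** Cancelling equal outermost letters, one of the words runs out first. *)
Lemma wapp_comparable w u (x y : A) : wapp w x = wapp u y -> wapp w x <> point A ->
  (exists z, w = u ++ z /\ y = wapp z x) \/ (exists z, u = w ++ z /\ x = wapp z y).
Proof.
elim: w u => [|f w IH] [|g u] /=.
- by move=> ->; left; exists [::].
- by move=> -> _; right; exists (g :: u).
- by move=> <- _; left; exists (f :: w).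
case: (pselect (f = g)) => [-> /(lapp_inj law) e nz | fg e nz].
  have [|[z [-> ->]]|[z [-> ->]]] := IH u e.
  - by move=> e0; apply: nz; rewrite e0 lapp_point.
  - by left; exists z.
  - by right; exists z.
by case: nz; rewrite (lapp_disjoint law fg e) lapp_point.
Qed.

Lemma wapp_free w u (x : A) : x <> point A -> wapp w x = wapp u x -> w = u.
Proof.
move=> nx e.
have nwx : wapp w x <> point A by move/wapp_eq_point.
by have [[[|f z] [-> ez]]|[[|f z] [-> ez]]] := wapp_comparable e nwx;
  rewrite ?cats0 //; case: nx; apply: (wapp_acyclic law (w := f :: z)).
Qed.

Definition linked (x y : A) : Prop := exists w u, wapp w x = wapp u y.

(** The variables are absorbed one at a time.  A variable linked to the current
    ancestor is comparable with it, so either it is already below or it becomes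
    the new ancestor.  In the latter case a variable not linked to the old
    ancestor is below the new one or not linked to it: if it were above the new
    one, it would be above the old one too. *)
Lemma common_ancestor (v : nat -> A) (n : nat) (x : A) : x <> point A ->
  exists c, [/\ c <> point A, exists w, x = wapp w c
    & forall i, i < n -> (exists w, v i = wapp w c) \/ ~ linked c (v i)].
Proof.
move=> nx; elim: n => [|n [c [nc [w xE] IH]]].
  by exists x; split=> //; exists [::].
have [[u [u' e]]|nl] := pselect (linked c (v n)); last first.
  exists c; split=> // [|i]; first by exists w.
  by rewrite ltnS leq_eqVlt => /orP[/eqP->|/IH]; [right|].
have nuc : wapp u c <> point A by move/wapp_eq_point.
have [[z [_ vnE]]|[z [_ cE]]] := wapp_comparable e nuc.
  exists c; split=> // [|i]; first by exists w.
  by rewrite ltnS leq_eqVlt => /orP[/eqP->|/IH]; first by left; exists z.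
have nvn : v n <> point A.
  by move=> e0; apply: nc; rewrite cE e0 wapp_point.
exists (v n); split=> // [|i].
  by exists (w ++ z); rewrite wapp_cat -cE.
rewrite ltnS leq_eqVlt => /orP[/eqP->|/IH[[y ->]|nl]].
- by left; exists [::].
- by left; exists (y ++ z); rewrite wapp_cat -cE.
have [[y [y' e']]|] := pselect (linked (v n) (v i)); last by right.
have nyv : wapp y (v n) <> point A by move/wapp_eq_point.
have [[y'' [_ ->]]|[y'' [_ vE]]] := wapp_comparable e' nyv.
  by left; exists y''.
by case: nl; exists [::], (z ++ y''); rewrite wapp_cat -vE.
Qed.

End Lawful.

(** * Collapsing to one generator *)

Section Collapse.
Variables A B : structure L.
Hypotheses (lawA : lawful A) (lawB : lawful B).
Variables (c : A) (b : B).
Hypothesis c_neq_point : c <> point A.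

(** The graph of a homomorphism from A to B, except that elements linked to [c]
    without being a word applied to [c] have no image: [c] may have
    predecessors in A that [b] lacks in B. *)
Definition collapse (x : A) (y : B) : Prop :=
  (exists2 w, x = wapp w c & y = wapp w b) \/ (~ linked c x /\ y = point B).

Lemma linked_wapp w : linked c (wapp w c).
Proof. by exists w, [::]. Qed.

Lemma collapse_op (o : op_symbol L) xs ys : (forall i, collapse (xs i) (ys i)) ->
  collapse (op_interp (o := o) xs) (op_interp (o := o) ys).
Proof.
case: o xs ys => [f|] xs ys xys; last first.
  right; rewrite !op_interp_point; split=> // -[w [u e]].
  by apply/c_neq_point/(wapp_eq_point lawA (w := w)); rewrite e wapp_point.
rewrite !op_interp_lapp; have [[w -> ->]|[nl ->]] := xys ord0.
  by left; exists (f :: w).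
right; rewrite (lapp_point lawB); split=> // -[w [u e]]; apply: nl.
by exists w, (rcons u f); rewrite -cats1 wapp_cat.
Qed.

Lemma collapse_functional x y y' : collapse x y -> collapse x y' -> y = y'.
Proof.
move=> [[w -> ->]|[nl ->]] [[w' e ->]|[nl' ->]] //.
- by rewrite (wapp_free lawA c_neq_point e).
- by case: nl'; apply: linked_wapp.
- by case: nl; rewrite e; apply: linked_wapp.
Qed.

Lemma collapse_inj w x y : b <> point B ->
  collapse (wapp w c) y -> collapse x y -> wapp w c = x.
Proof.
move=> nb [[u e ->]|[]]; last by case; apply: linked_wapp.
case=> [[u' -> e']|[_ /(wapp_eq_point lawB)] //].
by rewrite e (wapp_free lawB nb e').
Qed.

Lemma collapse_marked u x y : collapse x y ->
  (forall w, x = wapp w c -> marked (wact w u) b) -> marked u y.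
Proof.
move=> [[w -> ->]|[_ ->]] H; last exact: (marked_point lawB).
by apply/(marked_wapp lawB)/H.
Qed.

End Collapse.

(** Each premise P_u(w c) needs only P_(w u)(c), so the join of these finitely
    many elements of S controls all premises; this is where joins in S are
    used to code conjunctions. *)
Lemma premises_controlled (A : structure L) (v : nat -> A) (c : A) (n : nat)
    (ps : seq (atomic L)) :
    lawful A -> c <> point A ->
    (forall a, List.In a ps -> holds v a) ->
    (forall a, List.In a ps -> atomic_bound a <= n) ->
  exists2 s, marked s c & forall (B : structure L) (b : B) (v' : nat -> B),
    lawful B -> marked s b -> (forall i, i < n -> collapse c b (v i) (v' i)) ->
    forall a, List.In a ps -> holds v' a.
Proof.
move=> lawA nc; elim: ps => [|a ps IH] prem bound.
  by exists \bot%O; first exact: marked_bot.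
have [||s sc H] := IH.
- by move=> e Ie; apply: prem; right.
- by move=> e Ie; apply: bound; right.
have [t tc Ht] : exists2 t, marked t c & forall (B : structure L) (b : B) v',
    lawful B -> marked t b -> (forall i, i < n -> collapse c b (v i) (v' i)) ->
    holds v' a.
  have := prem a (or_introl erefl); have := bound a (or_introl erefl).
  case: a {prem bound} => [t u|u ts] /= le_n va.
    exists \bot%O; first exact: marked_bot.
    move: le_n; rewrite geq_max => /andP[lt lu] B b v' lawB _ vv'.
    have ct := eval_related (collapse_op lawA lawB nc) vv' lt.
    have cu := eval_related (collapse_op lawA lawB nc) vv' lu.
    by rewrite va in ct; apply: (collapse_functional lawA nc ct cu).
  rewrite rel_interp_marked in va.
  have cE (B : structure L) (b : B) v' : lawful B ->
      (forall i, i < n -> collapse c b (v i) (v' i)) ->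
      collapse c b (eval v (ts ord0)) (eval v' (ts ord0)).
    move=> lawB vv'; apply: (eval_related (collapse_op lawA lawB nc) vv').
    exact: leq_trans (leq_bigmax (F := fun j => term_bound (ts j)) _) le_n.
  have [[w xE]|nx] := pselect (exists w, eval v (ts ord0) = wapp w c).
    exists (wact w u); first by apply/(marked_wapp lawA); rewrite -xE.
    move=> B b v' lawB ub vv'; rewrite rel_interp_marked.
    apply: (collapse_marked lawB (cE _ _ _ lawB vv')) => w'.
    by rewrite xE => /(wapp_free lawA nc) <-.
  exists \bot%O; first exact: marked_bot.
  move=> B b v' lawB _ vv'; rewrite rel_interp_marked.
  apply: (collapse_marked lawB (cE _ _ _ lawB vv')) => w' xE.
  by case: nx; exists w'.
exists (s `|` t)%O; first by apply/(marked_join lawA).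
move=> B b v' lawB /(marked_join lawB)[sb tb] vv' e [<-|].
  exact: Ht lawB tb vv'.
exact: H lawB sb vv' e.
Qed.

(** * The congruence of a theory *)

Definition congruence_of (T : set (quasi_identity L)) : set (S * S) :=
  [set p | T (implication p.1 p.2) /\ T (implication p.2 p.1)].

Definition pointed_acts (A : structure L) : Prop := models A axiom.

Lemma theory_models_lawful T A : theories pointed_acts T -> models A T -> lawful A.
Proof.
by move=> [_ sub] mod; apply/axiomsP => q axq; apply/mod/sub => B; apply.
Qed.

Lemma congruence_ofP T s t : theories pointed_acts T ->
  congruence_of T (s, t) <->
  forall A, models A T -> forall x : A, marked s x <-> marked t x.
Proof.
move=> [closed sub]; split=> [[st ts] A mod x | H].
  by split; [have /implicationP := mod _ st | have /implicationP := mod _ ts]; apply.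
by split; apply: closed => A mod; apply/implicationP => x /(H A mod).
Qed.

Lemma congruence_of_Con T : theories pointed_acts T -> Con M (congruence_of T).
Proof.
move=> thT; split.
- split.
  + by move=> s; apply/(congruence_ofP _ _ thT).
  + move=> s t u /(congruence_ofP _ _ thT) st /(congruence_ofP _ _ thT) tu.
    by apply/(congruence_ofP _ _ thT) => A mod x; rewrite (st A mod) (tu A mod).
  + by move=> s t [].
- move=> s t u w /(congruence_ofP _ _ thT) st /(congruence_ofP _ _ thT) uw.
  apply/(congruence_ofP _ _ thT) => A mod x.
  have law := theory_models_lawful thT mod.
  by rewrite !(marked_join law) (st A mod) (uw A mod).
- move=> f s t Mf /(congruence_ofP _ _ thT) st.
  apply/(congruence_ofP _ _ thT) => A mod x.
  have law := theory_models_lawful thT mod.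
  by rewrite -!(marked_lapp law (exist _ f Mf)); apply: st.
Qed.

(** Otherwise T would prove that P_s(x) implies P_t(x), so s and s + t would be
    congruent modulo T, hence modulo T', against the behaviour of [c]. *)
Lemma separating_model T T' (A : structure L) (s t : S) (c : A) :
    theories pointed_acts T -> theories pointed_acts T' ->
    congruence_of T `<=` congruence_of T' -> models A T' ->
    marked s c -> ~ marked t c ->
  exists (B : structure L) (b : B), [/\ models B T, marked s b & ~ marked t b].
Proof.
move=> thT thT' sub mod sc ntc; apply: contrapT => noB.
have /sub /(congruence_ofP _ _ thT') H : congruence_of T (s, (s `|` t)%O).
  apply/(congruence_ofP _ _ thT) => B modB x.
  rewrite (marked_join (theory_models_lawful thT modB)); split=> [sx|[]//].
  by split=> //; apply: contrapT => ntx; apply: noB; exists B, x.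
apply: ntc; have /(H A mod) := sc.
by case/(marked_join (theory_models_lawful thT' mod)).
Qed.

(** If a quasi-identity of T failed in a model of T', the failure would survive
    in the substructure generated by an ancestor of an element that the
    conclusion speaks of, and [collapse] would carry it to a model of T. *)
Lemma congruence_of_reflects T T' : theories pointed_acts T -> theories pointed_acts T' ->
  congruence_of T `<=` congruence_of T' -> T `<=` T'.
Proof.
move=> thT thT' sub q Tq; apply: (thT'.1) => A mod v prem.
have lawA := theory_models_lawful thT' mod.
have [n bound] := premises_bounded (conclusion q :: premises q).
(* [t w] is the element of S whose predicate must stay false; it may depend on
   the word [w] that leads to [x] from the ancestor, which is yet to be found. *)
have transfer x t : x <> point A ->
    (forall c w, x = wapp w c -> c <> point A -> ~ marked (t w) c) ->
    exists c w (B : structure L) (b : B) v',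
      [/\ [/\ x = wapp w c, c <> point A, lawful B & ~ marked (t w) b],
        forall i, i < n -> collapse c b (v i) (v' i) & holds v' (conclusion q)].
  move=> nx Ht; have [c [nc [w xE] vc]] := common_ancestor lawA v n nx.
  have [|s sc Hs] := premises_controlled (n := n) lawA nc prem.
    by move=> a qa; apply: bound; right.
  have [B [b [modB sb ntb]]] :=
    separating_model thT thT' sub mod sc (Ht c w xE nc).
  have lawB := theory_models_lawful thT modB.
  have /choice[v' vv'] : forall i, exists y, i < n -> collapse c b (v i) y.
    move=> i; case: (ltnP i n) => [/vc[[u e]|nl]|_].
    - by exists (wapp u b) => _; left; exists u.
    - by exists (point B) => _; right.
    - by exists (point B).
  by exists c, w, B, b, v'; split=> //; apply: (modB q Tq); apply: Hs sb vv'.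
(* The equation is reflected from B only if [b] generates freely, which is
   ensured by separating P_1: [b] is then not the point. *)
have eqn_case t u : atomic_bound (Eqn t u) <= n -> eval v t <> point A ->
    (forall (B : structure L) (v' : nat -> B),
       holds v' (conclusion q) -> eval v' t = eval v' u) ->
    eval v t = eval v u.
  move=> /=; rewrite geq_max => /andP[lt lu] nt conc.
  have [|c [w [B [b [v' [[xE nc lawB ntb] vv' /conc e]]]]]] :=
      transfer _ (fun _ => \top%O) nt.
    by move=> c w _ nc /(marked_top lawA).
  have nb : b <> point B by move/(marked_top lawB).
  have ct := eval_related (collapse_op lawA lawB nc) vv' lt.
  have cu := eval_related (collapse_op lawA lawB nc) vv' lu.
  rewrite -e in cu; rewrite xE in ct *.
  exact: (collapse_inj lawB nb ct cu).
have := bound _ (or_introl erefl); move: transfer eqn_case; clear bound.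
case: (conclusion q) => [t u|r ts] transfer eqn_case le_n /=.
  have [t0|nt] := pselect (eval v t = point A); last exact: eqn_case.
  have [u0|nu] := pselect (eval v u = point A); first by rewrite t0 u0.
  by apply/esym/eqn_case => //=; rewrite maxnC.
rewrite rel_interp_marked; apply: contrapT => nr.
have nx : eval v (ts ord0) <> point A.
  by move=> e; apply: nr; rewrite e; apply: marked_point.
have [|c [w [B [b [v' [[xE nc lawB ntb] vv' /= rb]]]]]] :=
    transfer _ (fun w => wact w r) nx.
  by move=> c w xE nc /(marked_wapp lawA); rewrite -xE.
have := eval_related (collapse_op lawA lawB nc) vv'
  (leq_trans (leq_bigmax (F := fun j => term_bound (ts j)) ord0) le_n).
rewrite rel_interp_marked in rb; rewrite xE => -[[u e yE]|[]]; last first.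
  by case; apply: linked_wapp.
apply: ntb; rewrite (wapp_free lawA nc e).
by apply/(marked_wapp lawB); rewrite -yE.
Qed.

(** * The theory of a congruence *)

Lemma wact_bot w : wact w \bot%O = \bot%O.
Proof. by elim: w => //= f w IH; have [_ ->] := M_op (svalP f). Qed.

Lemma wact_top w : wact w \top%O = \top%O.
Proof. by elim: w => //= f w IH; rewrite (M_top (svalP f)). Qed.

Lemma wact_join w s t : wact w (s `|` t)%O = (wact w s `|` wact w t)%O.
Proof.
by elim: w s t => //= f w IH s t; have [-> _] := M_op (svalP f); apply: IH.
Qed.

(** [None] is the point and [Some w] the word [w] applied to a generator at
    which exactly the predicates in [I] hold. *)
Definition free_structure (I : S -> Prop) : structure L :=
  @Structure L (option word) (inhabits None)
    (fun o => match o return ('I_(op_arity (l := L) o) -> option word) -> option word with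
              | Some f => fun xs => omap (cons f) (xs ord0)
              | None => fun _ => None
              end)
    (fun s xs => if xs ord0 is Some w then I (wact w s) else True).

Lemma free_structure_lawful (I : S -> Prop) : I \bot%O ->
    (forall s t, I (s `|` t)%O <-> I s /\ I t) -> ~ I \top%O ->
  lawful (free_structure I).
Proof.
move=> I0 Ij I1; split.
- by case=> [w|] //=; rewrite /marked /= wact_bot.
- by move=> s t [w|]; rewrite /marked /= ?wact_join.
- by move=> f s [w|].
- by case=> [w|]; rewrite /marked /= ?wact_top; split.
- by move=> f [x|] [y|] //= [->].
- by move=> f g [x|] [y|] fg //= [].
- move=> w [u|] w0 // e; case: w0; apply/size0nil.
  have : wapp w (Some u : free_structure I) = Some (w ++ u).
    by elim: (w) => //= f z ->.
  rewrite e => -[/(congr1 size)]; rewrite size_cat => /esym/eqP.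
  by rewrite -{2}[size u]add0n eqn_add2r => /eqP.
Qed.

Definition theory_of_congruence (R : set (S * S)) : set (quasi_identity L) :=
  [set q | forall A, pointed_acts A ->
     (forall s t, R (s, t) -> satisfies A (implication s t)) -> satisfies A q].

Lemma theory_of_congruence_theory R : theories pointed_acts (theory_of_congruence R).
Proof.
split=> [q H A actA satR | q H A actA _]; last exact: H.
by apply: H => r; apply.
Qed.

(** The ideal [I] of all u that R puts below t is closed under R, and so are its
    inverse images under words; hence the free structure on [I] is a model, and
    its generator satisfies P_t.  If (s + t, t) is not in R then [I] omits s,
    and a fortiori 1, as the axioms on the point demand. *)
Lemma theory_of_congruence_implication R s t : Con M R ->
  theory_of_congruence R (implication t s) -> R ((s `|` t)%O, t).
Proof.
move=> [[Rrefl Rtrans Rsym] Rjoin Rop] imp; apply: contrapT => nst.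
pose I u := R ((u `|` t)%O, t).
have Idown u w : I (u `|` w)%O -> I u.
  move=> Iuw; have := Rjoin _ _ _ _ (Rrefl u) Iuw.
  by rewrite !joinA joinxx => /Rsym /Rtrans; apply.
have Rwact u w z : R (u, w) -> R (wact z u, wact z w).
  by elim: z u w => //= f z IH u w uw; apply/IH/Rop => //; apply: svalP.
have law : lawful (free_structure I).
  apply: free_structure_lawful.
  - by rewrite /I join0x; apply: Rrefl.
  - move=> u w; split=> [Iuw|[Iu Iw]].
      by split; [apply: Idown Iuw | apply: (@Idown _ u); rewrite joinC].
    have := Rjoin _ _ _ _ Iu Iw.
    by rewrite /I joinACA joinxx.
  - by move=> I1; apply/nst/(@Idown _ \top%O); rewrite joinx1.
have : marked s (Some [::] : free_structure I).
  move: (imp (free_structure I)); rewrite implicationP; apply.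
  - exact/axiomsP.
  - move=> u w uw; apply/implicationP => -[z|] //; rewrite /marked /= => Iu.
    apply: Rtrans Iu; apply/Rjoin; last exact: Rrefl.
    by apply/Rsym/Rwact.
  - by rewrite /marked /= /I joinxx; apply: Rrefl.
exact: nst.
Qed.

Lemma theory_of_congruenceK R : Con M R ->
  congruence_of (theory_of_congruence R) = R.
Proof.
move=> CR; have [[Rrefl Rtrans Rsym] _ _] := CR.
apply/seteqP; split=> -[s t]; last first.
  by move=> st; split=> A _ H; apply: H => //; apply: Rsym.
move=> [/= /(theory_of_congruence_implication CR) ts].
move=> /(theory_of_congruence_implication CR); rewrite joinC => st.
by apply: Rtrans st; apply: Rsym.
Qed.

End Representation.

Theorem corollary7 (d : Order.disp_t) (S : tbJoinSemilatticeType d)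
    (M : set (S -> S))
    (M_monoid : operator_monoid M)
    (M_reductive : reductive M)
    (M_cancel : right_cancellative M)
    (M_top : forall f, M f -> f \top%O = \top%O) :
  exists (L : language) (D : structure L -> Prop),
    quasivariety D /\ inclusion_isomorphic (theories D) (Con M).
Proof.
have [M_op _ _] := M_monoid.
exists (act_language M), (@pointed_acts d S M); split; first by exists (@axiom d S M).
exists (@congruence_of d S M); last first.
  move=> T T' thT thT'; split=> [sub p []|]; first by split; apply: sub.
  exact: congruence_of_reflects.
split.
- by move=> T; apply: congruence_of_Con.
- move=> T T' /[!inE] thT thT' e.
  by apply/seteqP; split; apply: congruence_of_reflects => //; rewrite e.
- move=> R CR; exists (theory_of_congruence R).
    exact: theory_of_congruence_theory.
  exact: theory_of_congruenceK.
Qed.
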